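(* Let $(Q,\mathcal P)$ be a thread quiver with path category $\mathcal C$, $\mathcal I$ an ideal of $\mathcal C$, $\mathfrak P$ a valid partition and $\mathcal M$ a sample of $\mathfrak P$. Consider the functors $\pi\iota:\overline{\mathcal A}^{\mathfrak P}(\mathcal M)\to\overline{\mathcal A}^{\mathfrak P}[\Sigma_{\mathfrak P}^{-1}]$ and $\Phi:\overline{\mathcal A}^{\mathfrak P}[\Sigma_{\mathfrak P}^{-1}]\to\overline{\mathcal A}^{\mathfrak P}(\mathcal M)$, and the functors $(\pi\iota)^*$, $\Phi^*$ they induce on pointwise finite-dimensional representations by precomposition. Then (1) $(\pi\iota)^*\circ\Phi^*$ is the identity on $\mathrm{rep}^{\mathrm{pwf}}(\overline{\mathcal A}^{\mathfrak P}(\mathcal M))$, and (2) $\Phi^*\circ(\pi\iota)^*$ is an auto-equivalence of $\mathrm{rep}^{\mathrm{pwf}}(\overline{\mathcal A}^{\mathfrak P}[\Sigma_{\mathfrak P}^{-1}])$.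
   Context: $k$ is an algebraically closed field. A thread quiver $(Q,\mathcal P)$ consists of a (possibly infinite) quiver $Q=(Q_0,Q_1,s,t)$ and, for every arrow $\alpha$, a (possibly empty) linearly ordered set $\mathcal P_\alpha$; $\overline{\mathcal P}_\alpha=\mathcal P_\alpha\sqcup\{\min(\alpha),\max(\alpha)\}$ is obtained by adding a new least element $\min(\alpha)$ and a new greatest element $\max(\alpha)$. Its path category $\mathcal C$ is the $k$-linear category with object set $Q_0\sqcup\bigsqcup_\alpha\mathcal P_\alpha$, where $\min(\alpha),\max(\alpha)$ are viewed as the objects $s(\alpha),t(\alpha)$ (they remain distinct elements of $\overline{\mathcal P}_\alpha$ even if $\alpha$ is a loop). For $x\le y$ in $\overline{\mathcal P}_\alpha$ there is a morphism $\eta_{y,x}=\eta_{yx}:x\to y$, with $\eta_{xx}=e_x$ the identity, $\eta_{zy}\eta_{yx}=\eta_{zx}$ for $x\le y\le z$, and $\eta_{\max(\alpha),\min(\alpha)}=\alpha$; write $\eta_{t(\alpha),x}:=\eta_{\max(\alpha),x}$ and $\eta_{x,s(\alpha)}:=\eta_{x,\min(\alpha)}$. The space $\mathrm{Hom}_{\mathcal C}(x,y)$ has as $k$-basis the distinct path-like elements from $x$ to $y$: the identities $e_x$, the $\eta_{yx}$, and the elements $\eta_{y,s(\beta)}\,p\,\eta_{t(\alpha),x}$ with $x\in\overline{\mathcal P}_\alpha$, $y\in\overline{\mathcal P}_\beta$ and $p$ a (possibly trivial) path of $Q$ from $t(\alpha)$ to $s(\beta)$. Composition is induced by concatenation of paths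 in $Q$ together with the relations $\eta_{zy}\eta_{yx}=\eta_{zx}$ for $x\le y\le z$ in $\overline{\mathcal P}_\alpha$ and $\eta_{\max(\alpha),\min(\alpha)}=\alpha$, for every arrow $\alpha$. For a $k$-linear category $\mathcal D$, $\mathrm{rep}^{\mathrm{pwf}}(\mathcal D)$ is the category of covariant $k$-linear functors from $\mathcal D$ to finite-dimensional $k$-vector spaces. An interval of a linearly ordered set is a nonempty subset $I$ such that $x<z<y$ with $x,y\in I$ implies $z\in I$. A valid partition $\mathfrak P$ is a partition of the objects of $\mathcal C$ such that $\{x\}$ is a cell for each $x\in Q_0$, and each $\mathcal P_\alpha$ is a union of finitely many cells that are intervals. A sample $\mathcal M$ of $\mathfrak P$ is a set of objects containing exactly one element of each cell. $\Sigma_{\mathfrak P}$ is the set of nonzero scalar multiples of the morphisms $\eta_{yx}$ with $x\le y$ in the same cell. Morphisms $f_1:x_1\to y_1$, $f_2:x_2\to y_2$ of $\mathcal C$ with $x_1,x_2$ in one cell $X$ and $y_1,y_2$ in one cell $Y$ are $\mathfrak P$-equivalent if there are $z\in X$, $w\in Y$ with $\eta_{wy_1}f_1\eta_{x_1z}=\eta_{wy_2}f_2\eta_{x_2z}$. The $\mathfrak P$-completion $\overline{\mathcal I}^{\mathfrak P}$ is the ideal of $\mathcal C$ generated by all $f$ that are $\mathfrak P$-equivalent to some $g\in\mathcal I$, and $\overline{\mathcal A}^{\mathfrak P}=\mathcal C/\overline{\mathcal I}^{\mathfrak P}$; $\overline{\mathcal A}^{\mathfrak P}(\mathcal M)$ is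 its full subcategory on $\mathcal M$, with inclusion functor $\iota$. $\Sigma_{\mathfrak P}$ (its image in $\overline{\mathcal A}^{\mathfrak P}$) admits a calculus of left fractions, and $\pi:\overline{\mathcal A}^{\mathfrak P}\to\overline{\mathcal A}^{\mathfrak P}[\Sigma_{\mathfrak P}^{-1}]$ is the $k$-linear localization functor: it inverts $\Sigma_{\mathfrak P}$, and every $k$-linear functor $F$ on $\overline{\mathcal A}^{\mathfrak P}$ inverting $\Sigma_{\mathfrak P}$ factors as $F=G\pi$ for a unique $k$-linear functor $G$. Let $\mathbf r:\overline{\mathcal A}^{\mathfrak P}\to\overline{\mathcal A}^{\mathfrak P}(\mathcal M)$ be the functor sending $x$ to the unique $s_x\in\mathcal M$ in the cell of $x$, and $p:x\to y$ to the unique (in $\overline{\mathcal A}^{\mathfrak P}$) morphism $p':s_x\to s_y$ that is $\mathfrak P$-equivalent to $p$. It inverts $\Sigma_{\mathfrak P}$, and $\Phi$ is the unique functor with $\Phi\pi=\mathbf r$. *)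

(* Defs.v *)
From HB Require Import structures.
From mathcomp Require Import all_boot all_order all_algebra.
From mathcomp Require Import boolp classical_sets cardinality.
From mathcomp Require Import freeg.

Set Implicit Arguments.
Unset Strict Implicit.
Unset Printing Implicit Defensive.

Import GRing.Theory.
Local Open Scope ring_scope.
Local Open Scope classical_set_scope.

Record category := Category {
  cobj :> Type;
  chom : cobj -> cobj -> Type;
  cid : forall x, chom x x;
  ccomp : forall x y z, chom y z -> chom x y -> chom x z;
  ccompA : forall x y z w (h : chom z w) (g : chom y z) (f : chom x y),
    ccomp h (ccomp g f) = ccomp (ccomp h g) f;
  ccomp1m : forall x y (f : chom x y), ccomp (cid y) f = f;
  ccompm1 : forall x y (f : chom x y), ccomp f (cid x) = f
}.
Arguments chom {c}.
Arguments cid {c}.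
Arguments ccomp {c x y z}.

Definition is_ciso (C : category) (x y : C) (f : chom x y) : Prop :=
  exists g : chom y x, ccomp g f = cid x /\ ccomp f g = cid y.

Record functor (C D : category) := Functor {
  cfobj :> C -> D;
  cfmap : forall x y, chom x y -> chom (cfobj x) (cfobj y);
  cfmap1 : forall x, cfmap (cid x) = cid (cfobj x);
  cfmapM : forall x y z (g : chom y z) (f : chom x y),
    cfmap (ccomp g f) = ccomp (cfmap g) (cfmap f)
}.
Arguments cfmap {C D} f {x y} : rename.

Definition idFunctor (C : category) : functor C C.
Proof. by exists (fun x => x) (fun x y f => f). Defined.

Definition compFunctor (C D E : category) (G : functor D E) (F : functor C D) :
  functor C E.
Proof.
exists (fun x => G (F x)) (fun x y f => cfmap G (cfmap F f)).
- by move=> x; rewrite !cfmap1.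
- by move=> x y z g f; rewrite !cfmapM.
Defined.

Definition nat_isomorphic (C D : category) (F G : functor C D) : Prop :=
  exists u : forall x, chom (F x) (G x),
    (forall x y (f : chom x y), ccomp (u y) (cfmap F f) = ccomp (cfmap G f) (u x))
    /\ (forall x, is_ciso (u x)).

Definition is_equivalence (C D : category) (F : functor C D) : Prop :=
  exists G : functor D C,
    nat_isomorphic (compFunctor G F) (idFunctor C) /\
    nat_isomorphic (compFunctor F G) (idFunctor D).

Record linCat (k : fieldType) := LinCat {
  obj :> Type;
  hom : obj -> obj -> lmodType k;
  idm : forall x, hom x x;
  hcomp : forall x y z, hom y z -> hom x y -> hom x z;
  compA : forall x y z w (h : hom z w) (g : hom y z) (f : hom x y),
    hcomp h (hcomp g f) = hcomp (hcomp h g) f;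
  comp1m : forall x y (f : hom x y), hcomp (idm y) f = f;
  compm1 : forall x y (f : hom x y), hcomp f (idm x) = f;
  comp_linl : forall x y z (f : hom x y), linear (fun g : hom y z => hcomp g f);
  comp_linr : forall x y z (g : hom y z), linear (fun f : hom x y => hcomp g f)
}.
Arguments hom {k l}.
Arguments idm {k l}.
Arguments hcomp {k l x y z}.

Notation "g ∘ f" := (hcomp g f) (at level 40, left associativity).

Section LinearCategories.
Variable k : fieldType.
Implicit Types C D E : linCat k.

Definition is_iso C (x y : C) (f : hom x y) : Prop :=
  exists g : hom y x, g ∘ f = idm x /\ f ∘ g = idm y.

Record linFun C D := LinFun {
  fobj :> C -> D;
  fmap : forall x y, hom x y -> hom (fobj x) (fobj y);
  fmap1 : forall x, fmap (idm x) = idm (fobj x);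
  fmapM : forall x y z (g : hom y z) (f : hom x y),
    fmap (g ∘ f) = fmap g ∘ fmap f;
  fmap_lin : forall x y, linear (@fmap x y)
}.
Arguments fmap {C D} l {x y}.

Definition idFun C : linFun C C.
Proof. by exists (fun x => x) (fun x y f => f). Defined.

Definition compFun C D E (G : linFun D E) (F : linFun C D) : linFun C E.
Proof.
exists (fun x => G (F x)) (fun x y f => fmap G (fmap F f)).
- by move=> x; rewrite !fmap1.
- by move=> x y z g f; rewrite !fmapM.
- by move=> x y a f g; rewrite !fmap_lin.
Defined.

Record natTrans C D (F G : linFun C D) := NatTrans {
  ntr :> forall x, hom (F x) (G x);
  ntr_nat : forall x y (f : hom x y), ntr y ∘ fmap F f = fmap G f ∘ ntr x
}.

Lemma natTransP C D (F G : linFun C D) (a b : natTrans F G) :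
  (forall x, a x = b x) -> a = b.
Proof.
case: a b => [a Ha] [b Hb] /= ab.
have {}ab : a = b by apply: functional_extensionality_dep.
by case: _ / ab Hb => Hb; congr NatTrans; apply: Prop_irrelevance.
Qed.

Definition ntid C D (F : linFun C D) : natTrans F F.
Proof. by exists (fun x => idm (F x)) => x y f; rewrite comp1m compm1. Defined.

Definition ntcomp C D (F G H : linFun C D) (b : natTrans G H) (a : natTrans F G) :
  natTrans F H.
Proof.
exists (fun x => b x ∘ a x) => x y f.
by rewrite -compA ntr_nat compA ntr_nat compA.
Defined.

Definition vectCat : linCat k.
Proof.
unshelve refine (@LinCat k (vectType k) (fun U V => 'Hom(U, V) : lmodType k)
          (fun U => \1%VF) (fun U V W g f => (g \o f)%VF) _ _ _ _ _).
- by move=> *; rewrite comp_lfunA.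
- by move=> *; rewrite comp_lfun1l.
- by move=> *; rewrite comp_lfun1r.
- by move=> U V W f c g1 g2; rewrite comp_lfunDl comp_lfunZl.
- by move=> U V W g c f1 f2; rewrite comp_lfunDr comp_lfunZr.
Defined.

(* A plain category: its Hom-sets quantify over the objects of D, and mathcomp *)
(* puts lmodType carriers in too small a universe to bundle them as modules.   *)
Definition rep D : category.
Proof.
apply: (@Category (linFun D vectCat) (fun F G => natTrans F G)
          (fun F => ntid F) (fun F G H => @ntcomp D vectCat F G H)).
- by move=> F G H K c b a; apply: natTransP => x; exact: (@compA _ vectCat).
- by move=> F G a; apply: natTransP => x; exact: (@comp1m _ vectCat).
- by move=> F G a; apply: natTransP => x; exact: (@compm1 _ vectCat).
Defined.

Definition pullback_nt C D E (H : linFun C D) (F G : linFun D E)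
  (a : natTrans F G) : natTrans (compFun F H) (compFun G H).
Proof. by exists (fun x => a (H x)) => x y f /=; rewrite ntr_nat. Defined.

Definition pullback C D (H : linFun C D) : functor (rep D) (rep C).
Proof.
exists (fun F : rep D => compFun F H : rep C)
       (fun F G a => @pullback_nt C D vectCat H F G a).
- by move=> F; apply: natTransP.
- by move=> F G K b a; apply: natTransP.
Defined.

Record ideal C := Ideal {
  imem :> forall x y : C, set (hom x y);
  ideal0 : forall x y : C, imem (0 : hom x y);
  ideal_lin : forall (x y : C) (c : k) (f g : hom x y),
    imem f -> imem g -> imem (c *: f + g);
  ideal_compl : forall (x y z : C) (g : hom y z) (f : hom x y),
    imem f -> imem (g ∘ f);
  ideal_compr : forall (x y z : C) (g : hom y z) (f : hom x y),
    imem g -> imem (g ∘ f)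
}.

Definition gen_ideal C (S : forall x y : C, set (hom x y)) : ideal C.
Proof.
exists (fun x y f => forall J : ideal C,
  (forall x y (g : hom x y), S x y g -> J x y g) -> J x y f).
- by move=> x y J _; exact: ideal0.
- by move=> x y c f g If Ig J SJ; apply: ideal_lin; [exact: If|exact: Ig].
- by move=> x y z g f If J SJ; apply: ideal_compl; exact: If.
- by move=> x y z g f If J SJ; apply: ideal_compr; exact: If.
Defined.

Section Quotient.
Variables (C : linCat k) (J : ideal C).

Section QuotientHom.
Variables x y : C.

Definition ideal_pred : {pred hom x y} := fun f => f \in J x y.

Lemma ideal_predP f : reflect (J x y f) (f \in ideal_pred).
Proof. by rewrite unfold_in; apply: (iffP idP); rewrite in_setE. Qed.

Lemma ideal_zmod_closed : zmod_closed ideal_pred.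
Proof.
split; first by apply/ideal_predP/ideal0.
move=> f g /ideal_predP Jf /ideal_predP Jg; apply/ideal_predP.
by rewrite addrC -scaleN1r; apply: ideal_lin.
Qed.
HB.instance Definition _ :=
  GRing.isZmodClosed.Build (hom x y) ideal_pred ideal_zmod_closed.

Definition quotHom : Type := {ideal_quot ideal_pred}.
HB.instance Definition _ := GRing.Zmodule.on quotHom.

Definition toQuot (f : hom x y) : quotHom := \pi_({ideal_quot ideal_pred})%qT f.
Definition ofQuot (u : quotHom) : hom x y := repr (u : {ideal_quot ideal_pred}).

Lemma ofQuotK u : toQuot (ofQuot u) = u.
Proof. exact: reprK. Qed.

Lemma toQuotP f g : toQuot f = toQuot g <-> J x y (f - g).
Proof.
split=> [/eqP|/ideal_predP fg]; last apply/eqP.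
  by rewrite -Quotient.idealrBE => /ideal_predP.
by rewrite -Quotient.idealrBE.
Qed.

Lemma toQuotD f g : toQuot (f + g) = toQuot f + toQuot g.
Proof. exact: (raddfD (\pi_({ideal_quot ideal_pred})%qT)). Qed.

Definition qscale (c : k) (u : quotHom) : quotHom := toQuot (c *: ofQuot u).

Lemma qscaleE c f : qscale c (toQuot f) = toQuot (c *: f).
Proof.
apply/toQuotP; rewrite -scalerBr -[_ *: _]addr0; apply: ideal_lin.
  by apply/toQuotP; exact: ofQuotK.
exact: ideal0.
Qed.

Lemma qscaleA c d u : qscale c (qscale d u) = qscale (c * d) u.
Proof. by rewrite -[u]ofQuotK !qscaleE scalerA. Qed.
Lemma qscale1 : left_id 1 qscale.
Proof. by move=> u; rewrite -[u]ofQuotK qscaleE scale1r. Qed.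
Lemma qscaleDr : right_distributive qscale +%R.
Proof.
move=> c u v; rewrite -[u]ofQuotK -[v]ofQuotK -toQuotD !qscaleE.
by rewrite scalerDr toQuotD.
Qed.
Lemma qscaleDl u : {morph qscale^~ u : c d / c + d}.
Proof. by move=> c d; rewrite -[u]ofQuotK !qscaleE scalerDl toQuotD. Qed.
HB.instance Definition _ := GRing.Zmodule_isLmodule.Build k quotHom
  qscaleA qscale1 qscaleDr qscaleDl.

Lemma toQuot_lin : linear toQuot.
Proof. by move=> c f g; rewrite toQuotD -qscaleE. Qed.
End QuotientHom.

Definition quotComp (x y z : C) (v : quotHom y z) (u : quotHom x y) :
  quotHom x z := toQuot (ofQuot v ∘ ofQuot u).

Lemma quotCompE (x y z : C) (g : hom y z) (f : hom x y) :
  quotComp (toQuot g) (toQuot f) = toQuot (g ∘ f).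
Proof.
apply/toQuotP.
set g' := ofQuot _; set f' := ofQuot _.
have Jg : J y z (g' - g) by apply/toQuotP; exact: ofQuotK.
have Jf : J x y (f' - f) by apply/toQuotP; exact: ofQuotK.
have -> : g' ∘ f' - g ∘ f = 1 *: ((g' - g) ∘ f') + g ∘ (f' - f).
  have El (h : hom x y) : (g' - g) ∘ h = g' ∘ h - g ∘ h.
    by rewrite addrC -scaleN1r comp_linl scaleN1r addrC.
  have Er (h : hom y z) : h ∘ (f' - f) = h ∘ f' - h ∘ f.
    by rewrite addrC -scaleN1r comp_linr scaleN1r addrC.
  by rewrite scale1r El Er addrA subrK.
by apply: ideal_lin; [exact: ideal_compr|exact: ideal_compl].
Qed.

Definition quotCat : linCat k.
Proof.
apply: (@LinCat k C (fun x y => quotHom x y : lmodType k)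
          (fun x => toQuot (idm x)) quotComp).
- move=> x y z w h g f; rewrite -[h]ofQuotK -[g]ofQuotK -[f]ofQuotK.
  by rewrite !quotCompE compA.
- by move=> x y f; rewrite -[f]ofQuotK quotCompE comp1m.
- by move=> x y f; rewrite -[f]ofQuotK quotCompE compm1.
- move=> x y z f c g h; rewrite -[f]ofQuotK -[g]ofQuotK -[h]ofQuotK.
  by rewrite -toQuot_lin !quotCompE comp_linl toQuot_lin.
- move=> x y z f c g h; rewrite -[f]ofQuotK -[g]ofQuotK -[h]ofQuotK.
  by rewrite -toQuot_lin !quotCompE comp_linr toQuot_lin.
Defined.

Definition quotFun : linFun C quotCat.
Proof.
apply: (@LinFun C quotCat (fun x => x) toQuot) => //.
- by move=> x y z g f; rewrite /= quotCompE.
- exact: toQuot_lin.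
Defined.
End Quotient.

Definition fullSub C (M : C -> Prop) : linCat k.
Proof.
apply: (@LinCat k {x : C | M x} (fun x y => hom (sval x) (sval y))
          (fun x => idm (sval x)) (fun x y z g f => g ∘ f)).
- by move=> *; exact: compA.
- by move=> *; exact: comp1m.
- by move=> *; exact: compm1.
- by move=> *; exact: comp_linl.
- by move=> *; exact: comp_linr.
Defined.

Definition fullIncl C (M : C -> Prop) : linFun (fullSub M) C.
Proof. by exists (fun x : fullSub M => sval x) (fun x y f => f). Defined.

Definition inverts C D (S : forall x y : C, set (hom x y)) (F : linFun C D) : Prop :=
  forall (x y : C) (f : hom x y), S x y f -> is_iso (fmap F f).

Definition is_localization C L (S : forall x y : C, set (hom x y))
    (p : linFun C L) : Prop :=
  inverts S p /\
  forall D (F : linFun C D),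
    inverts S F -> exists! G : linFun L D, F = compFun G p.

End LinearCategories.

Record threadQuiver := ThreadQuiver {
  tqv : Type;
  tqa : Type;
  src : tqa -> tqv;
  tgt : tqa -> tqv;
  tqdisp : Order.disp_t;
  thread : tqa -> orderType tqdisp
}.
Arguments src {t}.
Arguments tgt {t}.
Arguments thread {t}.

Section PathCategory.
Variables (k : fieldType) (Q : threadQuiver).

Inductive qpath : tqv Q -> tqv Q -> Type :=
| qnil v : qpath v v
| qcons a v : qpath (tgt a) v -> qpath (src a) v.

Fixpoint qcat u v w (p : qpath u v) : qpath v w -> qpath u w :=
  match p in qpath u v return qpath v w -> qpath u w with
  | qnil _ => fun q => q
  | qcons a _ p' => fun q => qcons (qcat p' q)
  end.

Definition qarrow (a : tqa Q) : qpath (src a) (tgt a) := qcons (qnil (tgt a)).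

Lemma qcatA u v w z (p : qpath u v) (q : qpath v w) (r : qpath w z) :
  qcat p (qcat q r) = qcat (qcat p q) r.
Proof. by elim: p q => //= a v' p IH q; rewrite IH. Qed.

Lemma qcatp1 u v (p : qpath u v) : qcat p (qnil v) = p.
Proof. by elim: p => //= a v' p ->. Qed.

Inductive tobj : Type :=
| vtx of tqv Q
| pt (a : tqa Q) of thread a.

Definition exitv (x : tobj) := match x with vtx v => v | pt a _ => tgt a end.
Definition entryv (x : tobj) := match x with vtx v => v | pt a _ => src a end.

(* [Thru p] is eta_{y,s(b)} p eta_{t(a),x} for x in P_a and y in P_b, where an  *)
(* eta is dropped when its endpoint x or y is a vertex. So e_v, eta_{t(a),x} and *)
(* eta_{x,s(a)} are [Thru] of trivial paths, and eta_{max(a),min(a)} is [Thru]   *)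
(* of the arrow a. [Eta] gives the eta_{yx} with x, y in P_a, including e_x;     *)
(* these differ from every [Thru], which leaves P_a. Hence distinct terms are    *)
(* distinct path-like elements.                                                  *)
Inductive plike : tobj -> tobj -> Type :=
| Thru x y (p : qpath (exitv x) (entryv y)) : plike x y
| Eta a (x y : thread a) (xy : (x <= y)%O) : plike (pt x) (pt y).

Definition pid (x : tobj) : plike x x :=
  match x with
  | vtx v => Thru (x := vtx v) (y := vtx v) (qnil v)
  | pt a x => Eta (Order.le_refl x)
  end.

(* eta_{t(a),x} eta_{x,s(a)} = a *)
Definition midpath (x : tobj) : qpath (entryv x) (exitv x) :=
  match x with vtx v => qnil v | pt a _ => qarrow a end.

Definition pre_eta (y z : tobj) : Type :=
  match y with
  | vtx _ => unit
  | pt a y => forall x : thread a, (x <= y)%O -> plike (pt x) z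
  end.

Definition pcomp x y z (g : plike y z) (f : plike x y) : plike x z :=
  match f in plike x y return plike y z -> plike x z with
  | Thru x y p => fun g =>
    match g in plike y z return qpath (exitv x) (entryv y) -> plike x z with
    | Thru y z q => fun p => Thru (qcat p (qcat (midpath y) q))
    | Eta a y z _ => fun p => Thru (y := pt z) p
    end p
  | Eta a x y xy => fun g =>
    match g in plike y z return pre_eta y z with
    | Thru y z q =>
      match y return qpath (exitv y) (entryv z) -> pre_eta y z with
      | vtx _ => fun=> tt
      | pt a y => fun q x _ => Thru (x := pt x) q
      end q
    | Eta a y z yz => fun x xy => Eta (Order.le_trans xy yz)
    end x xy
  end g.

Lemma plike_ptP a (x : thread a) (P : forall z, plike (pt x) z -> Prop) :
  (forall z (q : qpath (tgt a) (entryv z)), P z (Thru (x := pt x) q)) ->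
  (forall (y : thread a) (xy : (x <= y)%O), P (pt y) (Eta xy)) ->
  forall z (g : plike (pt x) z), P z g.
Proof.
move=> PT PE z g; move: P PT PE.
pose R u (z : tobj) : plike u z -> Prop :=
  match u return plike u z -> Prop with
  | vtx _ => fun=> True
  | pt a x => fun g => forall P : forall z, plike (pt x) z -> Prop,
      (forall z (q : qpath (tgt a) (entryv z)), P z (Thru (x := pt x) q)) ->
      (forall (y : thread a) (xy : (x <= y)%O), P (pt y) (Eta xy)) -> P z g
  end.
have : R _ _ g by case: {z} g => [[v|b y] z q|b y z yz] //= P PT PE.
exact.
Qed.

Lemma pcompA x y z w (h : plike z w) (g : plike y z) (f : plike x y) :
  pcomp h (pcomp g f) = pcomp (pcomp h g) f.
Proof.
case: f g => {x y} [x y p|a x y xy] g.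
  case: g h p => {y z} [y z q|a y z yz] h p.
    by case: h q => {z w} [z w r|a z w zw] q //=; rewrite !qcatA.
  by elim/plike_ptP: h.
elim/plike_ptP: g h => [{}z q|{}z yz] h; last first.
  by elim/plike_ptP: h => //= w' zw; congr Eta; exact: bool_irrelevance.
by case: h q => {w z} [z w r|b z w zw] q.
Qed.

Lemma pcomp1p x y (f : plike x y) : pcomp (pid y) f = f.
Proof.
case: f => {x y} [x [v|a y] p|a x y xy] //=; first by rewrite !qcatp1.
by congr Eta; exact: bool_irrelevance.
Qed.

Lemma pcompp1 x y (f : plike x y) : pcomp f (pid x) = f.
Proof.
case: f => {x y} [[v|a x] y p|a x y xy] //=.
by congr Eta; exact: bool_irrelevance.
Qed.

Definition phom (x y : tobj) : lmodType k := {freeg {classic plike x y} / k}.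

Definition pbasis x y (f : plike x y) : phom x y := << (f : {classic plike x y}) >>.

Lemma fglift_lin (T : choiceType) (V : lmodType k) (F : T -> V) :
  linear (fglift F).
Proof.
have FD : {morph fglift F : u v / u + v}.
  move=> u v; rewrite -{1}[v]opprK (lift_is_additive F).
  by rewrite -[- v]add0r !(lift_is_additive F) -{1}(subrr 0) (lift_is_additive F)
     subrr sub0r opprK.
have F0 : fglift F 0 = 0 by have := FD 0 0; rewrite addr0 => /eqP; rewrite addrC
  -subr_eq subrr eq_sym => /eqP.
have FZ c u : fglift F (c *: u) = c *: fglift F u.
  rewrite -[u]freeg_sumE scaler_sumr !(big_morph _ FD F0) scaler_sumr.
  apply: eq_bigr => z _; rewrite liftU.
  have -> : c *: << coeff z u *g z >> = << c * coeff z u *g z >>.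
    by apply/eqP/freeg_eqP => t; rewrite coeffZ !coeffU mulrA.
  by rewrite liftU scalerA.
by move=> c u v; rewrite FD FZ.
Qed.

Lemma linear_ext (T : choiceType) (V : lmodType k) (F G : {freeg T / k} -> V) :
  linear F -> linear G -> (forall t, F << t >> = G << t >>) -> F =1 G.
Proof.
move=> Flin Glin FG.
have H0 (H : {freeg T / k} -> V) : linear H -> H 0 = 0.
  by move=> Hl; have := Hl (-1) 0 0; rewrite !scaleN1r oppr0 addr0 addNr.
elim/freeg_ind_dom0 => [|c t u _ _ IH]; first by rewrite !H0.
have -> : << c *g t >> = c *: << t >> :> {freeg T / k}.
  by apply/eqP/freeg_eqP => z; rewrite coeffZ !coeffU mul1r.
by rewrite Flin Glin FG IH.
Qed.

Lemma fgliftE (T : choiceType) (V : lmodType k) (F : T -> V) u :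
  fglift F u = \sum_(t <- dom u) coeff t u *: F t.
Proof.
rewrite -{1}[u]freeg_sumE; elim: (dom u) => [|t s IH].
  rewrite !big_nil; have := fglift_lin F (-1) 0 0.
  by rewrite !scaleN1r oppr0 addr0 addNr.
by rewrite !big_cons -[X in fglift F (X + _)]scale1r fglift_lin scale1r liftU IH.
Qed.

Definition pathComp x y z (g : phom y z) (f : phom x y) : phom x z :=
  fglift (fun b : {classic plike y z} =>
    fglift (fun a : {classic plike x y} => pbasis (pcomp b a)) f) g.

Lemma pathCompB x y z (g : plike y z) (f : plike x y) :
  pathComp (pbasis g) (pbasis f) = pbasis (pcomp g f).
Proof. by rewrite /pathComp !liftU !scale1r. Qed.

Lemma pathComp_linl x y z (f : phom x y) :
  linear (fun g : phom y z => pathComp g f).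
Proof. exact: fglift_lin. Qed.

Lemma pathComp_linr x y z (g : phom y z) :
  linear (fun f : phom x y => pathComp g f).
Proof.
move=> c f1 f2; rewrite /pathComp !(fgliftE _ g) scaler_sumr -big_split.
apply: eq_bigr => b _; rewrite fglift_lin scalerDr.
by rewrite !scalerA (mulrC c).
Qed.

Lemma pathCompA x y z w (h : phom z w) (g : phom y z) (f : phom x y) :
  pathComp h (pathComp g f) = pathComp (pathComp h g) f.
Proof.
move: h; apply: linear_ext => [c h1 h2|c h1 h2|h]; rewrite ?pathComp_linl //.
move: g; apply: linear_ext => [c g1 g2|c g1 g2|g].
- by rewrite pathComp_linl pathComp_linr.
- by rewrite pathComp_linr pathComp_linl.
move: f; apply: linear_ext => [c f1 f2|c f1 f2|f]; rewrite ?pathComp_linr //.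
by rewrite !pathCompB pcompA.
Qed.

Lemma pathComp1m x y (f : phom x y) : pathComp (pbasis (pid y)) f = f.
Proof.
move: f; apply: linear_ext => [c f1 f2|//|f]; first by rewrite pathComp_linr.
by rewrite pathCompB pcomp1p.
Qed.

Lemma pathCompm1 x y (f : phom x y) : pathComp f (pbasis (pid x)) = f.
Proof.
move: f; apply: linear_ext => [c f1 f2|//|f]; first by rewrite pathComp_linl.
by rewrite pathCompB pcompp1.
Qed.

Definition pathCat : linCat k :=
  LinCat pathCompA pathComp1m pathCompm1 pathComp_linl pathComp_linr.

(* The eta_{yx} with x <= y in a common P_a, or x = y a vertex: these are the   *)
(* only ones needed inside a cell. In particular a loop a = eta_{max(a),min(a)} *)
(* at v is not one of the eta_{yx} of the cell {v}, min(a) and max(a) being     *)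
(* distinct elements.                                                           *)
Inductive eta : forall x y : tobj, phom x y -> Prop :=
| eta_vtx v : eta (pbasis (pid (vtx v)))
| eta_pt a (x y : thread a) (xy : (x <= y)%O) : eta (pbasis (Eta xy)).

Definition is_interval d (T : orderType d) (J : set T) : Prop :=
  J !=set0 /\
  forall x y z, J x -> J y -> (x < z)%O -> (z < y)%O -> J z.

Definition valid_partition (PP : set (set tobj)) : Prop :=
  [/\ partition PP id [set: tobj],
      forall v, PP [set vtx v] &
      forall a : tqa Q, exists F : set (set (thread a)),
        [/\ finite_set F,
            forall J, F J -> PP (@pt a @` J) /\ is_interval J &
            \bigcup_(J in F) J = [set: thread a]]].

Definition is_sample (PP : set (set tobj)) (M : set tobj) : Prop :=
  forall X, PP X -> exists! x, M x /\ X x.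

Section AlongFunctor.
(* Instantiated with the identity of C and with a projection onto a quotient.  *)
Variables (PP : set (set tobj)) (D : linCat k) (F : linFun pathCat D).

Definition cell_eta (X : set tobj) (x y : tobj) : set (hom (F x) (F y)) :=
  [set f | X x /\ X y /\ exists2 e : phom x y, eta e & f = fmap F e].

Definition Sigma (x y : tobj) : set (hom (F x) (F y)) :=
  [set f | exists X c e, [/\ PP X, c != 0, cell_eta X e & f = c *: e]].

Definition pequiv (x1 y1 x2 y2 : tobj)
    (f1 : hom (F x1) (F y1)) (f2 : hom (F x2) (F y2)) : Prop :=
  exists X Y, [/\ PP X, PP Y & exists z w
    (a1 : hom (F z) (F x1)) (a2 : hom (F z) (F x2))
    (b1 : hom (F y1) (F w)) (b2 : hom (F y2) (F w)),
    [/\ cell_eta X a1, cell_eta X a2, cell_eta Y b1, cell_eta Y b2 &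
        b1 ∘ f1 ∘ a1 = b2 ∘ f2 ∘ a2]].
End AlongFunctor.

Definition completion (PP : set (set tobj)) (I : ideal pathCat) :
    ideal pathCat :=
  gen_ideal (C := pathCat) (fun x y => [set f |
    exists (x' y' : tobj) (g : phom x' y'),
      I x' y' g /\ pequiv PP (F := idFun pathCat) f g]).

Definition Abar PP I : linCat k := quotCat (completion PP I).
Definition projAbar PP I : linFun pathCat (Abar PP I) :=
  quotFun (completion PP I).

Definition SigmaBar PP I (x y : Abar PP I) : set (hom x y) :=
  Sigma PP (F := projAbar PP I) (x := x) (y := y).

Definition AbarM PP I (M : set tobj) : linCat k :=
  fullSub (C := Abar PP I) M.
Definition inclM PP I (M : set tobj) : linFun (AbarM PP I M) (Abar PP I) :=
  fullIncl (C := Abar PP I) M.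

(* A morphism of A(M) from r x to r y is by definition one of A between the   *)
(* underlying objects.                                                        *)
Definition is_sampling PP I (M : set tobj)
    (r : linFun (Abar PP I) (AbarM PP I M)) : Prop :=
  (forall x : tobj, exists X, [/\ PP X, X x & X (sval (r x))]) /\
  (forall (x y : tobj) (p : hom (l := Abar PP I) x y),
     unique (fun p' : hom (l := Abar PP I) (sval (r x)) (sval (r y)) =>
       pequiv PP (F := projAbar PP I) p p')
     (fmap r p)).
End PathCategory.

(* Main.v *)
Require Import Defs.
From mathcomp Require Import all_boot all_order all_algebra.
From mathcomp Require Import boolp classical_sets.
From Stdlib Require Import Program.Equality.

(** The point is that [p iota Phi] is isomorphic to the identity of [L].
    Each [x] is joined to the sample point [s_x] of its cell by some [eta],
    which [p] inverts; as any two composites of [eta]s with the same endpoints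
    agree, these isomorphisms [p x -> p s_x] are compatible with the witnesses
    of P-equivalence, hence natural: [p] is isomorphic to [p iota r], that is
    to [p iota Phi p].  The universal property of [p] descends this isomorphism
    to [L], by lifting [p] to the linear category of isomorphisms of [L].
    Uniqueness of sampling gives [r iota = id], hence (1). *)

Set Implicit Arguments.
Unset Strict Implicit.
Unset Printing Implicit Defensive.

Import Defs GRing.Theory.
Local Open Scope ring_scope.
Local Open Scope classical_set_scope.

(** * Equality of functors, with casts on morphisms *)

Definition cast2 (T : Type) (H : T -> T -> Type) (x x' y y' : T)
    (ex : x = x') (ey : y = y') (f : H x y) : H x' y' :=
  eq_rect y (H x') (eq_rect x (H^~ y) f x' ex) y' ey.

Lemma cast2_id (T : Type) (H : T -> T -> Type) (x y : T)
    (ex : x = x) (ey : y = y) (f : H x y) : cast2 ex ey f = f.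
Proof.
by rewrite (Prop_irrelevance ex erefl) (Prop_irrelevance ey erefl).
Qed.

Lemma dep_choice (A : Type) (B : A -> Type) (P : forall x, B x -> Prop) :
  (forall x, exists y, P x y) -> exists f : forall x, B x, forall x, P x (f x).
Proof.
by move=> H; exists (fun x => sval (boolp.cid (H x))) => x; exact: svalP.
Qed.

(** Functors that agree on objects have morphism maps in different Hom types, so these are compared
    after a cast; proof irrelevance lets [e] be arbitrary. *)
Lemma functor_ext (C D : category) (F G : functor C D) (e : forall x, F x = G x) :
  (forall x y (f : chom x y), cast2 (e x) (e y) (cfmap F f) = cfmap G f) -> F = G.
Proof.
case: F G e => [F Fm F1 FM] [G Gm G1 GM] /= e.
have FG : F = G by apply: functional_extensionality_dep.
case: _ / FG Gm G1 GM e => Gm G1 GM e FGm.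
have {}FGm : Fm = Gm.
  apply: functional_extensionality_dep => x.
  apply: functional_extensionality_dep => y.
  by apply: functional_extensionality_dep => f; rewrite -FGm cast2_id.
case: _ / FGm G1 GM => G1 GM.
by congr Functor; apply: Prop_irrelevance.
Qed.

(** * Strict equalities of linear functors and of pullbacks *)

Section LinearFunctors.
Variable k : fieldType.
Implicit Types C D L : linCat k.

Lemma linFun_ext C D (F G : linFun C D) (e : forall x, F x = G x) :
  (forall x y (f : hom x y),
     cast2 (H := fun u v => hom u v) (e x) (e y) (fmap F f) = fmap G f) ->
  F = G.
Proof.
case: F G e => [F Fm F1 FM Fl] [G Gm G1 GM Gl] /= e.
have FG : F = G by apply: functional_extensionality_dep.
case: _ / FG Gm G1 GM Gl e => Gm G1 GM Gl e FGm.
have {}FGm : Fm = Gm.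
  apply: functional_extensionality_dep => x.
  apply: functional_extensionality_dep => y.
  by apply: functional_extensionality_dep => f; rewrite -FGm cast2_id.
case: _ / FGm G1 GM Gl => G1 GM Gl.
by congr LinFun; apply: Prop_irrelevance.
Qed.

Arguments linFun_ext {C D F G} & e.

Lemma compFunA C D E E' (H : linFun E E') (G : linFun D E) (F : linFun C D) :
  compFun H (compFun G F) = compFun (compFun H G) F.
Proof. by refine (linFun_ext (fun=> erefl) _). Qed.

Lemma compFunf1 C D (F : linFun C D) : compFun F (idFun C) = F.
Proof. by refine (linFun_ext (fun=> erefl) _). Qed.

Lemma compFun1f C D (F : linFun C D) : compFun (idFun D) F = F.
Proof. by refine (linFun_ext (fun=> erefl) _). Qed.

(** Equalities in [rep] are between whole functors, while natural transformations are compared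
    objectwise; this passes from one kind of cast to the other. *)
Lemma cast_natTrans C D (F F' G G' : linFun C D) (eF : F = F') (eG : G = G')
    (a : natTrans F G) (x : C) (eFx : F x = F' x) (eGx : G x = G' x) :
  cast2 (H := fun U V => natTrans U V) eF eG a x = cast2 (H := fun u v => hom u v) eFx eGx (a x).
Proof. by case: _ / eF eFx; case: _ / eG eGx => ? ?; rewrite !cast2_id. Qed.

Lemma natTrans_cast C D (F G : linFun C D) (a : natTrans F G) (x y : C)
    (e : x = y) (eF : F x = F y) (eG : G x = G y) :
  cast2 (H := fun u v => hom u v) eF eG (a x) = a y.
Proof. by case: _ / e eF eG => ? ?; rewrite cast2_id. Qed.

(** Precomposition reverses composition, which settles objects; on morphisms, [a (B (A x))] is
    transported to [a x] along [B (A x) = x]. *)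
Lemma pullback_section C D (A : linFun C D) (B : linFun D C) :
  compFun B A = idFun C ->
  compFunctor (pullback A) (pullback B) = idFunctor (rep C).
Proof.
move=> BA; have BAo x : B (A x) = x by rewrite -[RHS]/(idFun C x) -BA.
have e (F : rep C) : compFunctor (pullback A) (pullback B) F = idFunctor (rep C) F.
  by rewrite /= -compFunA BA compFunf1.
apply: (functor_ext (e := e)) => F G a; apply: natTransP => x.
have eF : F (B (A x)) = F x by rewrite BAo.
have eG : G (B (A x)) = G x by rewrite BAo.
transitivity (cast2 (H := fun u v => hom u v) eF eG (a (B (A x)))).
  exact: (cast_natTrans (F := compFun (compFun F B) A)
                        (G := compFun (compFun G B) A)).
exact: natTrans_cast.
Qed.

(** * Natural isomorphisms and their pullbacks *)

Lemma is_iso_fmap C D (F : linFun C D) (x y : C) (f : hom x y) :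
  is_iso f -> is_iso (fmap F f).
Proof. by case=> g [gf fg]; exists (fmap F g); rewrite -!fmapM gf fg !fmap1. Qed.

Definition lin_isomorphic C D (F G : linFun C D) : Prop :=
  exists u : forall x, hom (F x) (G x),
    (forall x y (f : hom x y), u y ∘ fmap F f = fmap G f ∘ u x)
    /\ (forall x, is_iso (u x)).

(** The component at a representation [F] is [F] applied to [u], with inverse [F] applied to [v].
    Naturality in [F] is the naturality of each [a : F -> G] at the morphisms [u x]. *)
Lemma pullback_isomorphic_id C D (A : linFun C D) (B : linFun D C) :
  lin_isomorphic (compFun A B) (idFun D) ->
  nat_isomorphic (compFunctor (pullback B) (pullback A)) (idFunctor (rep D)).
Proof.
case=> u [u_nat u_iso].
have uP x : exists v : hom x (A (B x)),
    v ∘ u x = idm (A (B x)) /\ u x ∘ v = idm x.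
  exact: u_iso.
have [v vP] := dep_choice uP.
have v_nat x y (f : hom x y) : v y ∘ f = fmap A (fmap B f) ∘ v x.
  have [_ uv] := vP x; have [vu _] := vP y.
  rewrite -[LHS]compm1 -uv -compA (compA f) -[f ∘ u x](u_nat x y f) !compA vu.
  by rewrite comp1m.
have Fu_nat (F : rep D) x y (f : hom x y) :
    fmap F (u y) ∘ fmap (compFun (compFun F A) B) f = fmap F f ∘ fmap F (u x).
  by rewrite -[RHS]fmapM -[f ∘ u x](u_nat x y f) fmapM.
exists (fun F : rep D => NatTrans (Fu_nat F) :
          chom (compFunctor (pullback B) (pullback A) F) (idFunctor (rep D) F)).
split.
  by move=> F G a; apply: natTransP => x; exact/esym/(ntr_nat a (u x)).
move=> F.
have Fv_nat x y (f : hom x y) :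
    fmap F (v y) ∘ fmap F f = fmap (compFun (compFun F A) B) f ∘ fmap F (v x).
  by rewrite -[LHS]fmapM v_nat fmapM.
exists (NatTrans (F := F) (G := compFun (compFun F A) B) Fv_nat).
split; apply: natTransP => x; have [vu uv] := vP x.
  transitivity (fmap F (v x ∘ u x)); first exact: (esym (fmapM F (v x) (u x))).
  by rewrite vu fmap1.
transitivity (fmap F (u x ∘ v x)); first exact: (esym (fmapM F (u x) (v x))).
by rewrite uv fmap1.
Qed.

(** The identity functor serves as quasi-inverse. *)
Lemma isomorphic_id_equivalence (C : category) (E : functor C C) :
  nat_isomorphic E (idFunctor C) -> is_equivalence E.
Proof.
by case=> u [u_nat u_iso]; exists (idFunctor C); split; exists u; split.
Qed.

(** * The linear category of isomorphisms *)

Section IsoCat.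
Variable L : linCat k.

(** The inverse is stored as data because [isoCod] conjugates with it. *)
Record isoObj := IsoObj {
  idom : L;
  icod : L;
  imor : hom idom icod;
  iinv : hom icod idom;
  imorK : iinv ∘ imor = idm idom;
  iinvK : imor ∘ iinv = idm icod
}.

(* A commutative square between isomorphisms is determined by its first leg, so *)
(* the arrows are those of the domains.                                         *)
Definition isoCat : linCat k.
Proof.
apply: (@LinCat k isoObj (fun X Y => hom (idom X) (idom Y))
          (fun X => idm (idom X)) (fun X Y Z g f => g ∘ f)).
- by move=> *; exact: compA.
- by move=> *; exact: comp1m.
- by move=> *; exact: compm1.
- by move=> *; exact: comp_linl.
- by move=> *; exact: comp_linr.
Defined.

Definition isoDom : linFun isoCat L.
Proof. by exists (fun X : isoCat => idom X) (fun X Y f => f). Defined.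

Definition isoCod : linFun isoCat L.
Proof.
exists (fun X : isoCat => icod X)
  (fun X Y (f : hom (idom X) (idom Y)) => imor Y ∘ f ∘ iinv X).
- by move=> X; rewrite /= compm1 iinvK.
- move=> X Y Z g f /=.
  by rewrite !compA -[in RHS](compA _ (iinv Y)) imorK compm1.
- by move=> X Y c f g; rewrite comp_linr comp_linl.
Defined.

Lemma isoDomCod : lin_isomorphic isoCod isoDom.
Proof.
exists (fun X : isoCat => iinv X); split=> [X Y f|X] /=.
  by rewrite !compA imorK comp1m.
by exists (imor X); rewrite iinvK imorK.
Qed.
End IsoCat.

(** * Descent of isomorphisms along a localization *)

Lemma lin_isomorphic_comp C D E (F G : linFun D E) (H : linFun C D) :
  lin_isomorphic F G -> lin_isomorphic (compFun F H) (compFun G H).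
Proof.
by case=> u [u_nat u_iso]; exists (fun x => u (H x)); split=> *;
  [exact: u_nat|exact: u_iso].
Qed.

Lemma localization_isomorphic_id C L (S : forall x y : C, set (hom x y))
    (p : linFun C L) (H : linFun L L) :
  is_localization S p -> lin_isomorphic p (compFun H p) ->
  lin_isomorphic H (idFun L).
Proof.
case=> p_inv p_univ [u [u_nat u_iso]].
have [v vP] := dep_choice u_iso.
(* View [u] as a functor to isomorphisms with domain functor [p]; naturality makes its codomain
   functor [H p]. *)
pose To x : isoCat L := IsoObj (vP x).1 (vP x).2.
have [T [ToE Tm]] : exists T : linFun C (isoCat L),
    compFun (isoDom L) T = p /\ compFun (isoCod L) T = compFun H p.
  unshelve eexists.
    apply: (@LinFun k C (isoCat L) To (fun x y f => fmap p f)).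
    - exact: fmap1.
    - exact: fmapM.
    - exact: fmap_lin.
  split; refine (linFun_ext (fun=> erefl) _) => x y f //=.
  by rewrite u_nat -compA (vP x).2 compm1.
(* Arrows of [isoCat] are arrows between domains, so an inverse in [L] is already one in
   [isoCat]. *)
have T_inv : inverts S T.
  have : inverts S (compFun (isoDom L) T) by rewrite ToE.
  by move=> dT_inv x y f /dT_inv[g gP]; exists g.
have [T' [TE _]] := p_univ _ _ T_inv.
(* Uniqueness in the universal property identifies the domain and codomain functors of [T'] with the
   identity and [H]. *)
have uniq (G : linFun L L) : inverts S (compFun G p) ->
    forall G', compFun G' p = compFun G p -> G' = G.
  by move=> /p_univ[G0 [_ G0u]] G' G'p; rewrite -(G0u G) // -(G0u G').
have dT : compFun (isoDom L) T' = idFun L.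
  by apply: uniq; rewrite ?compFun1f // -compFunA -TE.
have cT : compFun (isoCod L) T' = H.
  apply: uniq; last by rewrite -compFunA -TE.
  by move=> x y f /p_inv; exact: is_iso_fmap.
by rewrite -dT -cT; exact/lin_isomorphic_comp/isoDomCod.
Qed.

End LinearFunctors.

(** * Etas within a cell *)

Section Sampling.
Variables (k : fieldType) (Q : threadQuiver).

(** On a thread the only choice is the proof of [s <= t], which is irrelevant; at a vertex only the
    identity counts, loops being excluded from [eta]. *)
Lemma eta_uniq (x y : tobj Q) (e1 e2 : phom k x y) : eta e1 -> eta e2 -> e1 = e2.
Proof.
move=> e1P; case: e1P e2 => [v|a s t st] e2 e2P;
  dependent destruction e2P => //.
by congr (pbasis _ (Eta _)); exact: bool_irrelevance.
Qed.

Lemma eta_comp (x y z : tobj Q) (g : phom k y z) (f : phom k x y) :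
  eta g -> eta f -> eta (pathComp g f).
Proof.
move=> gP; case: gP f => [v|a s t st] f fP; dependent destruction fP; rewrite pathCompB /=;
  by [exact: eta_vtx|exact: eta_pt].
Qed.

Lemma eta_id (x : tobj Q) : eta (pbasis k (pid x)).
Proof. by case: x => [v|a x]; [exact: eta_vtx|exact: eta_pt]. Qed.

Variables (PP : set (set (tobj Q))) (HPP : valid_partition PP).

Lemma cell_inj (X Y : set (tobj Q)) (x : tobj Q) :
  PP X -> PP Y -> X x -> Y x -> X = Y.
Proof. by case: HPP => -[_ tI _] _ _ PX PY Xx Yx; apply: tI => //; exists x. Qed.

(** A cell with a vertex is a singleton, and a cell meeting a thread is one of the intervals
    covering it, hence linearly ordered. *)
Lemma eta_total (X : set (tobj Q)) (x y : tobj Q) : PP X -> X x -> X y ->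
  (exists e : phom k x y, eta e) \/ (exists e : phom k y x, eta e).
Proof.
move=> PX Xx Xy; case: (HPP) => _ PPv PPt.
case: x Xx => [v|a s] Xx.
  have XE := cell_inj PX (PPv v) Xx erefl.
  by move: Xy; rewrite XE => ->; left; eexists; exact: eta_vtx.
have [F [_ FP Fcover]] := PPt a.
have [J FJ Js] : (\bigcup_(J in F) J) s by rewrite Fcover.
have XE : X = pt (a := a) @` J by apply: cell_inj PX (FP _ FJ).1 Xx _; exists s.
move: Xy; rewrite XE => -[t _ <-].
by case/orP: (Order.TotalTheory.le_total s t) => st; [left|right];
  eexists; exact: (eta_pt _ st).
Qed.

(** * Sampling restricted to the sample *)

Variables (I : ideal (pathCat k Q)) (M : set (tobj Q)) (HM : is_sample PP M).
Variables (r : linFun (Abar PP I) (AbarM PP I M)) (Hr : is_sampling r).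

(** A sample point is the only element of [M] in its cell, hence its own representative; a morphism
    is P-equivalent to itself with identities as witnesses, so sampling fixes it. *)
Lemma sampling_id : compFun r (inclM PP I M) = idFun (AbarM PP I M).
Proof.
case: Hr => rcell runiq.
have e (x : AbarM PP I M) : r (sval x) = x.
  have [X [PX Xx Xrx]] := rcell (sval x).
  have [s [_ suniq]] := HM PX.
  apply: eq_sig_hprop => [*|]; first exact: Prop_irrelevance.
  by apply: etrans (esym (suniq _ _)) (suniq _ _); split=> //; exact: svalP.
apply: (linFun_ext (F := compFun r (inclM PP I M)) (G := idFun _) (e := e)).
move=> x y f /=.
have ff : pequiv PP (F := projAbar PP I) (f : hom (l := Abar PP I) _ _) f.
  have [X [PX Xx _]] := rcell (sval x); have [Y [PY Yy _]] := rcell (sval y).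
  exists X, Y; split=> //; exists (sval x), (sval y).
  have etaX (Z : set (tobj Q)) z : Z z ->
      cell_eta Z (F := projAbar PP I) (idm (projAbar PP I z)).
    by move=> Zz; split=> //; split=> //; exists (pbasis k (pid z)) => //;
      exact: eta_id.
  by do 4!eexists; split; [exact: etaX..|].
(* With free targets [x'] and [y'] the equalities of endpoints can be eliminated before uniqueness
   is used. *)
have key (x' y' : AbarM PP I M) (ex : r (sval x) = x') (ey : r (sval y) = y')
    (g : hom (l := Abar PP I) (sval x') (sval y')) :
  pequiv PP (F := projAbar PP I) (f : hom (l := Abar PP I) _ _) g ->
  cast2 (H := fun u v => hom (l := AbarM PP I M) u v) ex ey
    (fmap r (f : hom (l := Abar PP I) _ _)) = g.
  case: _ / ex g; case: _ / ey => g fg.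
  by have [_] := runiq _ _ (f : hom (l := Abar PP I) _ _); apply.
exact: key.
Qed.

(** * Sampling becomes isomorphic to the identity once cells are inverted *)

Variables (L : linCat k) (p : linFun (Abar PP I) L).
Hypothesis p_inv : inverts (SigmaBar (PP := PP) (I := I)) p.

Let q := compFun p (projAbar PP I).

Lemma cell_iso (X : set (tobj Q)) (x y : tobj Q) (e : phom k x y) :
  PP X -> X x -> X y -> eta e -> is_iso (fmap q e).
Proof.
move=> PX Xx Xy ee; apply: p_inv; exists X, 1, (fmap (projAbar PP I) e).
split; rewrite ?oner_neq0 ?scale1r //.
by split=> //; split=> //; exists e.
Qed.

(** Take [q e] or its inverse, as [e] goes from [x] to [y] or back. Uniqueness of etas gives both
    compatibilities, which hide this direction from later use. *)
Lemma cell_transport (X : set (tobj Q)) (x y : tobj Q) :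
  PP X -> X x -> X y -> exists t : hom (q x) (q y), [/\ is_iso t,
    forall z (a1 : phom k z x) (a2 : phom k z y),
      eta a1 -> eta a2 -> t ∘ fmap q a1 = fmap q a2 &
    forall w (b1 : phom k x w) (b2 : phom k y w),
      eta b1 -> eta b2 -> fmap q b2 ∘ t = fmap q b1].
Proof.
move=> PX Xx Xy; case: (eta_total PX Xx Xy) => -[e ee].
- exists (fmap q e); split; first exact: cell_iso PX _ _ _.
  + move=> z a1 a2 e1 e2; rewrite -(fmapM q).
    by rewrite (eta_uniq e2 (eta_comp ee e1)).
  + move=> w b1 b2 e1 e2; rewrite -(fmapM q).
    by rewrite (eta_uniq e1 (eta_comp e2 ee)).
- have [t [te et]] := cell_iso PX Xy Xx ee; exists t; split.
  + by exists (fmap q e).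
  + move=> z a1 a2 e1 e2; rewrite (eta_uniq e1 (eta_comp ee e2)).
    by rewrite (fmapM q (e : hom (l := pathCat k Q) _ _)) compA te comp1m.
  + move=> w b1 b2 e1 e2; rewrite (eta_uniq e2 (eta_comp e1 ee)).
    by rewrite (fmapM q (b1 : hom (l := pathCat k Q) _ _)) -compA et compm1.
Qed.

Lemma sampling_isomorphic :
  lin_isomorphic p (compFun (compFun p (inclM PP I M)) r).
Proof.
case: Hr => rcell runiq.
have tr x : exists t : hom (q x) (q (sval (r x))), [/\ is_iso t,
    forall z (a1 : phom k z x) (a2 : phom k z (sval (r x))),
      eta a1 -> eta a2 -> t ∘ fmap q a1 = fmap q a2 &
    forall w (b1 : phom k x w) (b2 : phom k (sval (r x)) w),
      eta b1 -> eta b2 -> fmap q b2 ∘ t = fmap q b1].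
  by have [X [PX Xx Xrx]] := rcell x; exact: cell_transport PX Xx Xrx.
have [t tP] := dep_choice tr.
exists t; split=> [x y f|x]; last by case: (tP x).
have [+ _] := runiq x y f.
case=> X [Y [PX PY [z [w [a1 [a2 [b1 [b2 []]]]]]]]].
move=> [_ [Xx [a1' a1e a1E]]] [Xz [_ [a2' a2e a2E]]].
move=> [_ [_ [b1' b1e b1E]]] [Yry [Yw [b2' b2e b2E]]].
rewrite {}a1E {}a2E {}b1E {}b2E => /(congr1 (fun h => fmap p h)).
rewrite !fmapM => E.
have {}E : fmap q b1' ∘ fmap p f ∘ fmap q a1' =
    fmap q b2' ∘ fmap p (fmap r f : hom (l := Abar PP I) _ _) ∘ fmap q a2' := E.
have [_ tx _] := tP x; have [_ _ ty] := tP y.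
(* Under [q], [b1'] is [b2'] after [t y] and [a2'] is [t x] after [a1']. This leaves the naturality
   square between [q b2'] and [q a1'], which [b3] and [a3] cancel. *)
have [a3 [_ a3K]] := cell_iso PX Xz Xx a1e.
have [b3 [b3K _]] := cell_iso PY Yry Yw b2e.
move: E; rewrite -(ty _ _ _ b1e b2e) -(tx _ _ _ a1e a2e).
move=> /(congr1 (fun h => b3 ∘ h ∘ a3)).
by rewrite -!compA a3K !compm1 !compA b3K !comp1m.
Qed.

End Sampling.

Theorem corollary3p7 (k : closedFieldType) (Q : threadQuiver)
    (I : ideal (pathCat k Q)) (PP : set (set (tobj Q)))
    (M : set (tobj Q))
    (HPP : valid_partition PP) (HM : is_sample PP M)
    (L : linCat k) (p : linFun (Abar PP I) L)
    (Hp : is_localization (SigmaBar (PP := PP) (I := I)) p)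
    (r : linFun (Abar PP I) (AbarM PP I M)) (Hr : is_sampling r)
    (Phi : linFun L (AbarM PP I M)) (HPhi : compFun Phi p = r) :
  compFunctor (pullback (compFun p (inclM PP I M))) (pullback Phi) =
    idFunctor (rep (AbarM PP I M)) /\
  is_equivalence
    (compFunctor (pullback Phi) (pullback (compFun p (inclM PP I M)))).
Proof.
split; first by apply: pullback_section; rewrite compFunA HPhi sampling_id.
have [p_inv _] := Hp.
apply/isomorphic_id_equivalence/pullback_isomorphic_id.
(* It suffices to compare after precomposing with [p], where [Phi p = r] brings in sampling. *)
apply: localization_isomorphic_id Hp _.
by rewrite -compFunA HPhi; exact: sampling_isomorphic p_inv.
Qed.
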